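(* Let $X$ be a nonempty set with basepoint $b\in X$, and let $(A^t)_{t\ge 0}$ be a max-plus linear semigroup with kernel on $X$ such that (i) $A^*(x,y)$ is finite for all $x,y\in X$, and (ii) for all $t\ge 0$ and $x,y\in X$, $A^t(x,y)=\sup_\gamma I(\gamma)$, where the supremum is over all paths $\gamma:[0,t]\to X$ from $x$ to $y$. Assume that the Martin space $\mathscr{M}$ is first countable. Then for all $\xi\in\mathscr{M}^m$ there exists an almost-geodesic $\gamma$ converging to $\xi$, i.e. such that $K(\cdot,\gamma(t))$ converges to $\xi$ in $\mathscr{M}$ as $t\to\infty$.
   Context: Semigroup. Write $\mathbb{R}_{\max}=\mathbb{R}\cup\{-\infty\}$ and $\overline{\mathbb{R}}_{\max}=\mathbb{R}\cup\{\pm\infty\}$, with $-\infty$ absorbing for addition; suprema of empty sets are $-\infty$. A max-plus linear semigroup with kernel on a set $X$ is a family $(A^t)_{t\ge0}$ of operators from $\overline{\mathbb{R}}_{\max}^X$ to itself such that each $A^t$ has the form $A^tg(x)=\sup_{y\in X}(A^t(x,y)+g(y))$ for some kernel $(x,y)\mapsto A^t(x,y)\in\overline{\mathbb{R}}_{\max}$, with $A^0=I$ (the identity operator, with kernel $0$ if $x=y$ and $-\infty$ otherwise) and $A^{s+t}=A^sA^t$ (composition) for all $s,t\ge0$. Equivalently to the last property, $A^{s+t}(x,y)=\sup_{z\in X}(A^s(x,z)+A^t(z,y))$. A function $\phi:X\to\mathbb{R}_{\max}$ is harmonic if $A^t\phi=\phi$ for all $t\ge0$. Martin space. Put $A^*=\sup_{t\ge0}A^t$,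 i.e. $A^*(x,y)=\sup_{t\ge 0}A^t(x,y)$. The Martin kernel is $K(x,y)=A^*(x,y)-A^*(b,y)$. The Martin space $\mathscr{M}$ is the closure of $\mathscr{K}=\{K(\cdot,y)\mid y\in X\}\subset\mathbb{R}^X$ in the topology of pointwise convergence (with the induced topology). For $\xi:X\to\mathbb{R}_{\max}$ and $\eta\in\mathscr{M}$, $$\mu_\xi(\eta):=\inf_{W\ni\eta}\ \sup_{x\in X,\ K(\cdot,x)\in W}\left(A^*(b,x)+\xi(x)\right),$$ the infimum being over all neighbourhoods $W$ of $\eta$ in $\mathscr{M}$. For $\eta,\xi\in\mathscr{M}$ set $H(\eta,\xi):=\mu_\xi(\eta)$. The minimal boundary $\mathscr{M}^m$ is the set of $\xi\in\mathscr{M}$ that are harmonic and satisfy $H(\xi,\xi)=0$. Paths. A path is an arbitrary map $\gamma$ from a closed interval of $\mathbb{R}_+=[0,\infty)$ to $X$. For $t_0<t_1<\dots<t_n$ in the domain of $\gamma$, $I(t_0,\dots,t_n;\gamma):=\sum_{i=0}^{n-1}A^{t_{i+1}-t_i}(\gamma(t_i),\gamma(t_{i+1}))$. The reward of $\gamma:[s_0,s_1]\to X$ is $I(\gamma):=\inf I(t_0,\dots,t_n;\gamma)$, the infimum being over all finite increasing sequences in $[s_0,s_1]$ with $t_0=s_0$ and $t_n=s_1$. An almost-geodesic with parameter $\epsilon$ is a path $\gamma:\mathbb{R}_+\to X$ such that for all $n\in\mathbb{N}$ with $n\ge1$ and all $0\le t_1<t_2<\dots<t_n$, $I(t_1,\dots,t_n;\gamma)\ge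 A^*(\gamma(t_1),\gamma(t_n))-\epsilon$. An almost-geodesic is a path that is an almost-geodesic with parameter $\epsilon$ for some real $\epsilon>0$. *)

(* Defs.v *)
From HB Require Import structures.
From mathcomp Require Import all_boot all_order all_algebra.
From mathcomp Require Import all_classical all_reals all_analysis.
Set Implicit Arguments.
Unset Strict Implicit.
Unset Printing Implicit Defensive.
Import Order.TTheory GRing.Theory Num.Theory.
Import numFieldNormedType.Exports.
Local Open Scope classical_set_scope.
Local Open Scope ring_scope.

Definition first_countable (T : topologicalType) : Prop :=
  forall x : T, exists B : set_system T,
    [/\ countable B, B `<=` nbhs x &
        forall U, nbhs x U -> exists2 V, B V & V `<=` U].

(* Throughout, -oo is absorbing for the addition of \bar R: adde satisfies
   +oo + -oo = -oo, which is the max-plus convention. *)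

Section MaxPlusSemigroup.
Local Open Scope ereal_scope.
Context {R : realType} {X : Type}.

Definition maxplus_op (a : X -> X -> \bar R) (g : X -> \bar R) : X -> \bar R :=
  fun x => ereal_sup [set a x y + g y | y in [set: X]].

(* The semigroup is given by its kernels A t; a max-plus kernel is determined
   by its operator.  Only the values of A at times t >= 0 are ever used. *)
Definition maxplus_semigroup (A : R -> X -> X -> \bar R) : Prop :=
  maxplus_op (A 0%R) = id /\
  forall s t : R, (0 <= s)%R -> (0 <= t)%R ->
    maxplus_op (A (s + t)%R) = maxplus_op (A s) \o maxplus_op (A t).

Variable A : R -> X -> X -> \bar R.

(* phi is a function with values in R \cup {-oo}. *)
Definition harmonic (phi : X -> \bar R) : Prop :=
  (forall x, phi x != +oo) /\
  forall t : R, (0 <= t)%R -> maxplus_op (A t) phi = phi.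

Definition Astar (x y : X) : \bar R :=
  ereal_sup [set A t x y | t in [set t : R | (0 <= t)%R]].

(* Real-valued through [fine]: this is the intended difference whenever Astar
   takes finite values. *)
Definition martin_kernel (b x y : X) : R := fine (Astar x y - Astar b y).

Definition martin_col (b y : X) : {ptws X -> R} := (martin_kernel b)^~ y.

Definition martin_space (b : X) : set {ptws X -> R} :=
  closure (range (martin_col b)).

Lemma martin_col_in (b y : X) : martin_col b y \in martin_space b.
Proof. by apply/mem_set/subset_closure; exists y. Qed.

(* K(., y) as a point of the Martin space, the latter being coerced to the type
   of its elements, which carries the induced topology. *)
Definition martin_embed (b y : X) : martin_space b :=
  SigSub (martin_col_in b y).

Definition martin_mu (b : X) (xi : X -> \bar R) (eta : martin_space b) :
    \bar R :=
  ereal_inf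
    [set ereal_sup [set Astar b x + xi x | x in [set x | W (martin_embed b x)]]
    | W in (nbhs eta : set_system (martin_space b))].

Definition martin_fun (b : X) (xi : martin_space b) : X -> \bar R :=
  fun x => ((set_val xi : X -> R) x)%:E.

Definition martin_H (b : X) (eta xi : martin_space b) : \bar R :=
  martin_mu (martin_fun xi) eta.

Definition minimal_boundary (b : X) : set (martin_space b) :=
  [set xi | harmonic (martin_fun xi) /\ martin_H xi xi = 0].

(* Paths are represented by total maps gamma : R -> X, of which only the values
   on the relevant interval matter.  A finite sequence t_0 < ... < t_n is the
   restriction of t : nat -> R to {0, ..., n}; n = 0 is allowed. *)
Definition increasing_upto (n : nat) (t : nat -> R) : Prop :=
  forall i, (i < n)%N -> (t i < t i.+1)%R.

Definition path_sum (n : nat) (t : nat -> R) (gamma : R -> X) : \bar R :=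
  \sum_(0 <= i < n) A (t i.+1 - t i)%R (gamma (t i)) (gamma (t i.+1)).

Definition reward (s0 s1 : R) (gamma : R -> X) : \bar R :=
  ereal_inf [set v | exists n t, [/\ increasing_upto n t, t 0%N = s0,
                                     t n = s1 & v = path_sum n t gamma]].

Definition almost_geodesic_with (eps : R) (gamma : R -> X) : Prop :=
  forall (n : nat) (t : nat -> R), (0 <= t 0%N)%R -> increasing_upto n t ->
    Astar (gamma (t 0%N)) (gamma (t n)) - eps%:E <= path_sum n t gamma.

Definition almost_geodesic (gamma : R -> X) : Prop :=
  exists2 eps : R, (0 < eps)%R & almost_geodesic_with eps gamma.

End MaxPlusSemigroup.

Arguments minimal_boundary {R X} A b _.

(* Main.v *)
Require Import Defs.
From mathcomp Require Import all_boot all_order all_algebra.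
From mathcomp Require Import all_classical all_reals all_analysis.
From mathcomp Require Import ring lra.
Import Order.TTheory GRing.Theory Num.Theory.
Import numFieldNormedType.Exports.
Set Implicit Arguments.
Unset Strict Implicit.
Local Open Scope classical_set_scope.
Local Open Scope ring_scope.

(** Write v for the point xi of the minimal boundary, seen as a real function
on X. It is harmonic, hence superharmonic: A^t(x,y) + v(y) <= v(x). The Doob
transform A^t(x,y) - v(x) + v(y) is therefore a nonpositive kernel that still
satisfies the semigroup inequality, and along a path the transformed rewards
telescope: the sum over t_0 < ... < t_n is I(t_0, ..., t_n; gamma)
- v(gamma(t_0)) + v(gamma(t_n)). As A^*(x,y) <= v(x) - v(y), a path all of whose
transformed sums are at least -eps is an almost-geodesic with parameter eps.

Such a path is made of infinitely many pieces ([minimal_step]). By harmonicity,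
v(x) is nearly A^1(x,z) + v(z) for some z; the duration 1 spent here makes the
concatenated path run for ever. Since H(xi,xi) = 0, there are y with K(.,y) as
close to xi as one wishes and A^*(b,y) + v(y) nearly 0; for those y the number
A^*(z,y) + v(y) = K(z,y) + A^*(b,y) + v(y) is nearly v(z), so that some
A^t(z,y) + v(y) is nearly v(z) too. The semigroup inequality gives a transformed
weight of duration 1 + t from x to y that is nearly 0, and the hypothesis on
paths realises it by a path of nearly that reward. Errors 2^-(k+1) in the k-th
piece add up to at most 2^-k from the k-th piece on; a sum over times that miss
the junctions is handled by inserting the junctions, which can only decrease it
([slack_glue], [concat_chain]).

The whole path converges, and not only the junction points. The function
F_x(t) = A^*(x,gamma(t)) + v(gamma(t)) is at most v(x), and it drops by at most
2^-k after the k-th junction ([concat_green]). At the junctions F_b tends to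
v(b) = 0 and F_x = K(x,.) + F_b tends to v(x), because the junction points
follow a countable base of neighbourhoods of xi. Hence F_x and F_b tend to v(x)
and 0 along the whole path, and so does K(x,gamma(t)) = F_x(t) - F_b(t) to
v(x). *)

(** * Pointwise convergence and countable bases *)

Lemma cvg_initialP (S : choiceType) (T : topologicalType) (f : S -> T)
    (F : set_system S) (s : S) : Filter F ->
  F --> (s : initial_topology f) <-> f @ F --> f s.
Proof.
move=> FF; split => [Fs|fFs].
  exact: cvg_trans (cvg_app f Fs) (@initial_continuous S T f s).
move=> U [_ [[V oV <-] Vfs] VU]; apply: filterS VU _.
by apply: fFs; apply: open_nbhs_nbhs.
Qed.

Lemma cvg_ptwsP (I : Type) (T : topologicalType) (F : set_system (I -> T))
    (f : I -> T) : Filter F ->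
  {ptws, F --> f} <-> forall i, g i @[g --> F] --> f i.
Proof.
move=> FF; split => [/cvg_sup + i|cvF]; first by move=> /(_ i)/cvg_initialP.
by apply/cvg_sup => i; apply/cvg_initialP; exact: cvF.
Qed.

Lemma martin_cvgP (R : realType) (X : Type) (A : R -> X -> X -> \bar R) (b : X)
    (F : set_system (martin_space A b)) (xi : martin_space A b) : Filter F ->
  F --> xi <->
  forall x, (set_val eta : X -> R) x @[eta --> F] --> (set_val xi : X -> R) x.
Proof.
move=> FF; split=> [Fxi x|cvF].
  have /cvg_initialP/cvg_ptwsP := Fxi; exact.
by apply/cvg_initialP/cvg_ptwsP => x; exact: cvF.
Qed.

(** The first k sets of an enumeration of a countable base are intersected, so
that entering the k-th set eventually means staying close to the point. *)
Lemma first_countable_seq (T : topologicalType) (x : T) :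
  first_countable T -> exists U : nat -> set T, (forall k, nbhs x (U k)) /\
  (forall V, nbhs x V -> exists k, forall j, (k <= j)%N -> U j `<=` V).
Proof.
move=> /(_ x)[B [/pfcard_geP[B0|[g]] Bx Bbase]].
  by have [V] := Bbase _ filterT; rewrite B0.
exists (fun k => [set y | forall i, (i <= k)%N -> g i y]); split.
  have gx i : nbhs x (g i) by apply: Bx; apply: (@funS _ _ _ _ g).
  elim=> [|k IHk].
    by apply: filterS (gx 0%N) => y gy i; rewrite leqn0 => /eqP ->.
  apply: filterS2 IHk (gx k.+1) => y gk gk1 i.
  by rewrite leq_eqVlt => /orP[/eqP -> //|]; exact: gk.
move=> V /Bbase[W BW WV].
have [k _ gk] := @surj _ _ _ _ g _ BW.
by exists k => j kj y /(_ k kj); rewrite gk; exact: WV.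
Qed.

(** * Sums of a superadditive weight along increasing times *)

Section Chains.
Context {R : realType}.
Implicit Types (c : R -> R -> \bar R) (a s m t d e : R) (l : seq R).
Local Open Scope ereal_scope.

Fixpoint chain_sum c a l : \bar R :=
  if l is t :: l' then c a t + chain_sum c t l' else 0.

Lemma chain_sum_rcons c a l t :
  chain_sum c a (rcons l t) = chain_sum c a l + c (last a l) t.
Proof.
by elim: l a => [|u l IHl] a /=; rewrite ?adde0 ?add0e // IHl addeA.
Qed.

Lemma chain_sum_telescope c (v : R -> R) a l :
  chain_sum (fun s t => c s t + (v t - v s)%:E) a l =
  chain_sum c a l + (v (last a l) - v a)%:E.
Proof.
elim: l a => [|t l IHl] a /=; first by rewrite subrr adde0.
rewrite IHl addeACA; congr (_ + _).
by rewrite -EFinD; congr _%:E; lra.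
Qed.

(** An almost-geodesic is tested on sequences of times with arbitrary ends, so
the ends of the sequences are left free in the interval from s to t here. *)
Definition slack c s t d :=
  forall a l, (s <= a)%R -> path <%R a l -> (last a l <= t)%R ->
    (- d)%:E <= chain_sum c a l.

Lemma slack_refl c s : slack c s s 0.
Proof.
move=> a [|t l] sa; first by rewrite /= oppr0.
move=> /(order_path_min lt_trans)/allP/(_ _ (mem_last t l)) /= al ls.
by have := lt_le_trans (le_lt_trans sa al) ls; rewrite ltxx.
Qed.

Section Superadditive.
Variable c : R -> R -> \bar R.
Hypothesis c_le0 : forall s t, (s <= t)%R -> c s t <= 0.
Hypothesis c_super : forall s m t, (s <= m)%R -> (m <= t)%R ->
  c s m + c m t <= c s t.

(** Inserting the time m into the sequence cuts it in two; superadditivity says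
that the single step jumping over m was worth at least the two new ones. *)
Lemma chain_split a m l : (a <= m)%R -> path <%R a l -> (m <= last a l)%R ->
  exists l1 l2, [/\ path <%R a l1, last a l1 = m, path <%R m l2,
    last m l2 = last a l &
    chain_sum c a l1 + chain_sum c m l2 <= chain_sum c a l].
Proof.
elim: l a => [|t l IHl] a am /=.
  move=> _ ma; have <- : a = m by apply/le_anti; rewrite am.
  by exists [::], [::]; split; rewrite //= adde0.
move=> /andP[a_t tl] ml; have [tm|mt] := leP t m.
  have [l1 [l2 [al1 l1m ml2 l2l le12]]] := IHl _ tm tl ml.
  by exists (t :: l1), l2; split; rewrite //= ?a_t // -addeA leeD2l.
move: am; rewrite le_eqVlt => /orP[/eqP am|am].
  by exists [::], (t :: l); split; rewrite //= ?mt ?tl // add0e am.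
exists [:: m], (t :: l); split; rewrite //= ?am ?mt //.
by rewrite adde0 addeA leeD2r// c_super// ltW.
Qed.

Lemma slack_glue s m t d e : (s <= m)%R -> (m <= t)%R ->
  slack c s m d -> slack c m t e -> slack c s t (d + e).
Proof.
move=> sm mt sd me a l sa al lt.
have d0 : (0 <= d)%R.
  by have := sd m [::] sm isT (lexx _); rewrite lee_fin oppr_le0.
have e0 : (0 <= e)%R.
  by have := me m [::] (lexx _) isT mt; rewrite lee_fin oppr_le0.
have [ma|/ltW am] := leP m a.
  by apply: le_trans (me _ _ ma al lt); rewrite lee_fin; lra.
have [lm|/ltW ml] := leP (last a l) m.
  by apply: le_trans (sd _ _ sa al lm); rewrite lee_fin; lra.
have [l1 [l2 [al1 l1m ml2 l2l]]] := chain_split am al ml.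
apply: le_trans; rewrite opprD EFinD leeD//.
  by apply: sd; rewrite ?l1m.
by apply: me; rewrite ?l2l.
Qed.

(** Prolonging a sequence to both ends of the interval adds nonpositive terms,
so the sequences that reach both ends are the worst ones. *)
Lemma slack_full s t d :
  (forall l, path <%R s l -> last s l = t -> (- d)%:E <= chain_sum c s l) ->
  slack c s t d.
Proof.
move=> full.
have toend a l : (s <= a)%R -> path <%R a l -> last a l = t ->
    (- d)%:E <= chain_sum c a l.
  rewrite le_eqVlt => /orP[/eqP <-|sa al lt]; first exact: full.
  apply: le_trans (full (a :: l) _ _) _ => //=; first by rewrite sa.
  by rewrite geeDr// c_le0// ltW.
move=> a l sa al; rewrite le_eqVlt => /orP[/eqP|lt]; first exact: toend.
apply: le_trans (toend a (rcons l t) sa _ _) _; rewrite ?last_rcons//.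
  by rewrite rcons_path al.
by rewrite chain_sum_rcons geeDl// c_le0// ltW.
Qed.

End Superadditive.

Section PathSums.
Context {X : Type} (A : R -> X -> X -> \bar R).

Lemma path_sum_chain n (t : nat -> R) (gamma : R -> X) :
  path_sum A n t gamma =
  chain_sum (fun s u => A (u - s)%R (gamma s) (gamma u)) (t 0%N)
    [seq t i.+1 | i <- iota 0 n].
Proof.
rewrite /path_sum; elim: n t => [|n IHn] t; first by rewrite big_geq.
rewrite big_nat_recl// (IHn (fun i => t i.+1)) /=; congr (_ + chain_sum _ _ _).
by rewrite (iotaDl 1 0 n) -map_comp.
Qed.

Lemma chain_path_sum a l (gamma : R -> X) :
  chain_sum (fun s u => A (u - s)%R (gamma s) (gamma u)) a l =
  path_sum A (size l) (nth 0%R (a :: l)) gamma.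
Proof. by rewrite path_sum_chain [map _ _](mkseq_nth 0%R l). Qed.

Lemma increasing_upto_path n (t : nat -> R) : increasing_upto n t ->
  path <%R (t 0%N) [seq t i.+1 | i <- iota 0 n].
Proof.
move=> tS; apply/(pathP 0%R) => i; rewrite size_map size_iota => ltin.
rewrite (nth_map 0%N) ?size_iota// nth_iota//.
case: i ltin => [|i] ltin /=; first exact: tS.
by rewrite (nth_map 0%N) ?size_iota ?nth_iota ?(ltnW ltin)//; exact: tS.
Qed.

Lemma path_increasing_upto a l : path <%R a l ->
  increasing_upto (size l) (nth 0%R (a :: l)).
Proof. by move=> /(pathP 0%R) al i il; exact: al. Qed.

Lemma increasing_upto_le n (t : nat -> R) i j : increasing_upto n t ->
  (i <= j)%N -> (j <= n)%N -> (t i <= t j)%R.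
Proof.
move=> tS; elim: j => [|j IHj]; first by rewrite leqn0 => /eqP->.
rewrite leq_eqVlt => /orP[/eqP-> //|ij] jn.
by apply: le_trans (IHj ij (ltnW jn)) (ltW (tS _ jn)).
Qed.

(** The kernels depend on time differences only, so a path run from time T has
the reward of the path run from time 0. *)
Lemma reward_shift (T h : R) (g gamma : R -> X) n (t : nat -> R) :
  (forall s, (T <= s <= T + h)%R -> gamma s = g (s - T)%R) ->
  increasing_upto n t -> t 0%N = T -> t n = (T + h)%R ->
  reward A 0 h g <= path_sum A n t gamma.
Proof.
move=> gammaE tS t0 tn; apply: ereal_inf_lbound.
exists n, (fun i => t i - T)%R; split => //.
- by move=> i ltin; rewrite ltrD2r tS.
- by rewrite t0 subrr.
- by rewrite tn addrC addKr.
have gammaT i : (i <= n)%N -> gamma (t i) = g (t i - T)%R.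
  by move=> ltin; rewrite gammaE// -tn -t0 !(increasing_upto_le tS).
apply: eq_big_nat => i /andP[_ ltin]; rewrite !gammaT ?(ltnW ltin)//.
by congr (A _ _ _); lra.
Qed.
End PathSums.
End Chains.

(** * Concatenation of paths *)

Section Concat.
Context {R : realType} {X : Type}.
Variables (h : nat -> R) (g : nat -> R -> X).
Hypothesis h1 : forall k, 1 <= h k.

Definition switch_time k := \sum_(i < k) h i.

Lemma switch_timeS k : switch_time k.+1 = switch_time k + h k.
Proof. exact: big_ord_recr. Qed.

(** Pieces of duration at least 1 make the concatenated path defined at all
nonnegative times. *)
Lemma switch_time_nat k : k%:R <= switch_time k.
Proof.
elim: k => [|k IHk]; first by rewrite /switch_time big_ord0.
by rewrite switch_timeS -natr1 lerD.
Qed.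

Lemma switch_time_le : {homo switch_time : j k / (j <= k)%N >-> j <= k}.
Proof.
apply: homo_leq => //; first exact: le_trans.
by move=> k; rewrite switch_timeS lerDl (le_trans ler01).
Qed.

Lemma concat_paths : (forall k, g k (h k) = g k.+1 0) ->
  exists gamma : R -> X, forall k s,
    switch_time k <= s <= switch_time k + h k ->
    gamma s = g k (s - switch_time k).
Proof.
move=> gS.
pose piece (s : R) := [set k | switch_time k <= s < switch_time k.+1].
exists (fun s => let k := xget 0%N (piece s) in g k (s - switch_time k)).
have gammaE k s : piece s k -> xget 0%N (piece s) = k.
  move=> ksk; have := xgetPex 0%N (ex_intro _ k ksk).
  move: ksk; rewrite /piece /=; set j := xget _ _ => /andP[ks sk] /andP[js sj].
  apply/eqP; rewrite eqn_leq; apply/andP; split; rewrite leqNgt; apply/negP.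
    by move=> /switch_time_le kj; lra.
  by move=> /switch_time_le jk; lra.
move=> k s /andP[ks]; rewrite -switch_timeS le_eqVlt => /orP[/eqP ->|sk] /=.
  (* at a junction the half-open pieces select the later path *)
  rewrite (gammaE k.+1); last first.
    by rewrite /piece /= lexx [ltRHS]switch_timeS ltrDl (lt_le_trans ltr01).
  by rewrite subrr -gS switch_timeS addrC addKr.
by rewrite (gammaE k)// /piece /= ks sk.
Qed.

End Concat.

(** * Superharmonic functions and the Doob transform *)

Section Semigroup.
Context {R : realType} {X : Type} (A : R -> X -> X -> \bar R) (b : X).
Hypothesis semigroupA : maxplus_semigroup A.
Local Open Scope ereal_scope.

(** Composition of operators is turned into the inequality between kernels by
evaluating both sides at the max-plus indicator of y, which recovers the kernel
of an operator. *)
Lemma semigroup_super s t x y z : (0 <= s)%R -> (0 <= t)%R ->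
  A s x z + A t z y <= A (s + t)%R x y.
Proof.
move=> s0 t0; have [_ /(_ s t s0 t0) AD] := semigroupA.
pose unit_y z := if `[< z = y >] then 0 else -oo : \bar R.
have op_unit a w : maxplus_op a unit_y w = a w y :> \bar R.
  apply/eqP; rewrite eq_le; apply/andP; split.
    apply: ge_ereal_sup => _ [u _ <-]; rewrite /unit_y; case: asboolP => [->|_].
      by rewrite adde0.
    by rewrite addeC addNye leNye.
  apply: ereal_sup_ubound; exists y => //.
  by rewrite /unit_y asboolT// adde0.
rewrite -(op_unit (A (s + t)%R)) AD /=.
by apply: ereal_sup_ubound; exists z => //; rewrite op_unit.
Qed.

Lemma kernel_le_Astar t x y : (0 <= t)%R -> A t x y <= Astar A x y.
Proof. by move=> t0; apply: ereal_sup_ubound; exists t. Qed.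

Hypothesis finA : forall x y, Astar A x y \is a fin_num.

Definition green x y : R := fine (Astar A x y).

Lemma greenE x y : (green x y)%:E = Astar A x y.
Proof. exact: fineK. Qed.

Lemma martin_kernelE x y :
  martin_kernel A b x y = (green x y - green b y)%R.
Proof. by rewrite /martin_kernel -!greenE -EFinB. Qed.

Lemma green_super t x y z : (0 <= t)%R ->
  (green x z)%:E + A t z y <= (green x y)%:E.
Proof.
move=> t0; have := kernel_le_Astar z y t0; rewrite -(greenE z).
have := fun s s0 => @semigroup_super s t x y z s0 t0.
case: (A t z y) => [r AsA _| |_ _]; [|by []|by rewrite addeC addNye leNye].
rewrite !greenE -leeBrDr//; apply: ge_ereal_sup => _ [s s0 <-].
rewrite leeBrDr//; apply: le_trans (AsA s s0) (kernel_le_Astar _ _ _).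
exact: addr_ge0.
Qed.

Section Superharmonic.
Variable v : X -> R.
Hypothesis v_super : forall t x y, (0 <= t)%R -> A t x y + (v y)%:E <= (v x)%:E.

(** This is the passage to the supremum over t in the superharmonicity
inequality. *)
Lemma superharmonic_green x y : (green x y + v y <= v x)%R.
Proof.
rewrite -lerBrDr -lee_fin EFinB greenE; apply: ge_ereal_sup => _ [t t0 <-].
by rewrite leeBrDr// v_super.
Qed.

(** The Doob transform of the semigroup by v, along gamma: in max-plus algebra,
conjugation by v is the addition of a coboundary. *)
Definition doob (gamma : R -> X) s t : \bar R :=
  A (t - s)%R (gamma s) (gamma t) + (v (gamma t) - v (gamma s))%:E.

Lemma doob_le0 gamma s t : (s <= t)%R -> doob gamma s t <= 0.
Proof.
rewrite -subr_ge0 => /(@v_super _ (gamma s) (gamma t)) vA.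
by rewrite /doob EFinB addeA leeBlDr// add0e.
Qed.

Lemma doob_super gamma s m t : (s <= m)%R -> (m <= t)%R ->
  doob gamma s m + doob gamma m t <= doob gamma s t.
Proof.
move=> sm mt; rewrite /doob addeACA -EFinD.
have -> : (t - s = (m - s) + (t - m))%R by lra.
have -> : (v (gamma m) - v (gamma s) + (v (gamma t) - v (gamma m)) =
   v (gamma t) - v (gamma s))%R by lra.
by rewrite leeD2r// semigroup_super// subr_ge0.
Qed.

Lemma chain_doob gamma a l :
  chain_sum (doob gamma) a l =
  path_sum A (size l) (nth 0%R (a :: l)) gamma +
  (v (gamma (last a l)) - v (gamma a))%:E.
Proof. by rewrite -chain_path_sum -(chain_sum_telescope _ (v \o gamma)). Qed.

Lemma path_sum_doob gamma n (t : nat -> R) :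
  path_sum A n t gamma + (v (gamma (t n)) - v (gamma (t 0%N)))%:E =
  chain_sum (doob gamma) (t 0%N) [seq t i.+1 | i <- iota 0 n].
Proof.
rewrite [RHS](chain_sum_telescope _ (v \o gamma)) path_sum_chain /=.
suff -> : last (t 0%N) [seq t i.+1 | i <- iota 0 n] = t n by [].
by case: n => [//|n]; rewrite -[in LHS]addn1 iotaD map_cat last_cat.
Qed.

Section Concat.
Variables (h : nat -> R) (g : nat -> R -> X) (gamma : R -> X).
Hypothesis h1 : forall k, (1 <= h k)%R.
Hypothesis gammaE : forall k s,
  (switch_time h k <= s <= switch_time h k + h k)%R ->
  gamma s = g k (s - switch_time h k)%R.
Hypothesis g_reward : forall k,
  (v (g k 0%R) - v (g k (h k)) - 2 ^- k.+1)%:E <= reward A 0 (h k) (g k).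

Lemma slack_piece k :
  slack (doob gamma) (switch_time h k) (switch_time h k.+1) (2 ^- k.+1).
Proof.
apply: slack_full => [s t|l Tl lE]; first exact: doob_le0.
have h0 : (0 <= h k)%R by apply: le_trans (h1 k).
have gamma0 : gamma (switch_time h k) = g k 0%R.
  by rewrite (@gammaE k) ?subrr// lexx lerDl.
have gammah : gamma (switch_time h k.+1) = g k (h k).
  by rewrite switch_timeS (@gammaE k) ?lexx ?lerDl ?h0// addrC addKr.
rewrite chain_doob lE gamma0 gammah -leeBlDr// -EFinB.
apply: le_trans
  (reward_shift A (@gammaE k) (path_increasing_upto Tl) _ _) => //.
  by apply: le_trans (g_reward k); rewrite lee_fin; lra.
by rewrite -switch_timeS -lE (last_nth 0%R).
Qed.

Lemma slack_pieces k n :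
  slack (doob gamma) (switch_time h k) (switch_time h (k + n))
    (2 ^- k - 2 ^- (k + n)).
Proof.
elim: n => [|n IHn].
  by rewrite addn0 subrr; exact: slack_refl.
have pow m : (2 ^- m = 2 ^- m.+1 + 2 ^- m.+1 :> R)%R.
  by rewrite exprS; field.
have -> : (2 ^- k - 2 ^- (k + n.+1) =
  (2 ^- k - 2 ^- (k + n)) + 2 ^- (k + n).+1 :> R)%R.
  by rewrite addnS (pow (k + n)%N); lra.
apply: slack_glue IHn _; first exact: doob_super.
- by apply: switch_time_le; rewrite ?leq_addr.
- by apply: switch_time_le; rewrite ?leq_add2l.
- by rewrite addnS; exact: slack_piece.
Qed.

(** The errors of the pieces from the k-th one on are 2^-(k+1), 2^-(k+2), ...,
with sum 2^-k; a finite sequence of times lies below some junction, where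
[slack_pieces] applies. *)
Lemma concat_chain k a l : (switch_time h k <= a)%R -> path <%R a l ->
  (- 2 ^- k)%:E <= chain_sum (doob gamma) a l.
Proof.
move=> ka al; pose n := (Num.trunc (last a l)).+1.
have ln : (last a l <= switch_time h (k + n))%R.
  apply: le_trans (ltW (truncnS_gt _)) _.
  apply: le_trans (switch_time_nat h1 _) _.
  by apply: switch_time_le; rewrite ?leq_addl.
apply: le_trans (slack_pieces ka al ln).
by rewrite lee_fin opprB lerDr// invr_ge0 exprn_ge0.
Qed.

(** The transformed sums are at least -1, and superharmonicity bounds
A^* between the endpoints by the telescoped difference of v. *)
Lemma concat_almost_geodesic : almost_geodesic A gamma.
Proof.
exists 1%R => // n t t0 tS.
have := concat_chain (k:=0) _ (increasing_upto_path tS).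
rewrite /switch_time big_ord0 expr0 invr1 => /(_ t0).
rewrite -path_sum_doob -leeBlDr// -greenE -!EFinB.
apply: le_trans; rewrite lee_fin.
by have := superharmonic_green (gamma (t 0%N)) (gamma (t n)); lra.
Qed.

(** Going first to the junction point and then along gamma for the remaining
time gives a lower bound of A^*(x,gamma(s)); the single transformed step from
the junction to s is worth at least -2^-k. *)
Lemma concat_green k x s : (switch_time h k < s)%R ->
  (green x (gamma (switch_time h k)) + v (gamma (switch_time h k)) - 2 ^- k
   <= green x (gamma s) + v (gamma s))%R.
Proof.
move=> ks; have := @concat_chain k _ [:: s] (lexx _); rewrite /= ks.
move=> /(_ isT); rewrite adde0 /doob => c.
have := @green_super (s - switch_time h k)%R x (gamma s)
  (gamma (switch_time h k)).
rewrite subr_ge0 ltW// => /(_ isT); move: c; case: (A _ _ _) => // r.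
by rewrite -!EFinD !lee_fin; lra.
Qed.

End Concat.
End Superharmonic.
End Semigroup.

(** * Pieces of path towards a point of the minimal boundary *)

Section MinimalPoint.
Context {R : realType} {X : Type} (A : R -> X -> X -> \bar R) (b : X).
Hypothesis semigroupA : maxplus_semigroup A.
Hypothesis finA : forall x y, Astar A x y \is a fin_num.
Hypothesis pathA : forall (t : R) (x y : X), 0 <= t ->
  A t x y = ereal_sup [set reward A 0 t gamma
                      | gamma in [set gamma : R -> X |
                                  gamma 0 = x /\ gamma t = y]].
Variable xi : martin_space A b.
Hypothesis xi_min : minimal_boundary A b xi.

Let v : X -> R := set_val xi.

Lemma harmonic_super t x y : 0 <= t -> (A t x y + (v y)%:E <= (v x)%:E)%E.
Proof.
move=> t0; have [[_ /(_ t t0) Av] _] := xi_min.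
rewrite -[leRHS]/(martin_fun xi x) -Av.
by apply: ereal_sup_ubound; exists y.
Qed.

(** If the supremum over W of A^*(b,y) + v(y) were negative, so would be the
infimum H(xi,xi). *)
Lemma minimal_near e (W : set (martin_space A b)) : 0 < e -> nbhs xi W ->
  exists y, W (martin_embed A b y) /\ - e < green A b y + v y.
Proof.
move=> e0 Wxi; have [_ H0] := xi_min.
pose S := [set (Astar A b x + martin_fun xi x)%E
          | x in [set x | W (martin_embed A b x)]].
have : ((- e)%:E < ereal_sup S)%E.
  apply: (@lt_le_trans _ _ (martin_H xi xi)).
    by rewrite H0 lte_fin oppr_lt0.
  by apply: ereal_inf_lbound; exists W.
move=> /ereal_sup_gt[_ [y Wy <-]] ey; exists y; split => //.
by move: ey; rewrite -greenE// -EFinD lte_fin.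
Qed.

Lemma nbhs_martin x e : 0 < e ->
  nbhs xi [set eta : martin_space A b | `|(set_val eta : X -> R) x - v x| < e].
Proof.
move=> e0; have /martin_cvgP/(_ x)/cvgr_distC_lt := @cvg_id _ (nbhs xi).
exact.
Qed.

(** All Martin kernels vanish at b, and some are close to xi there. *)
Lemma martin_base0 : v b = 0.
Proof.
apply/eqP; rewrite -normr_eq0 eq_le normr_ge0 andbT.
apply/ler_addgt0Pl => e e0; rewrite addr0.
have [y [/= + _]] := minimal_near e0 (nbhs_martin b e0).
by rewrite [X in `|X - _|]martin_kernelE// subrr sub0r normrN => /ltW.
Qed.

(** The path goes to a nearly optimal z for A^1, then to a point y close to xi
for which A^*(z,y) + v(y) is nearly v(z). *)
Lemma minimal_step x e (W : set (martin_space A b)) : 0 < e -> nbhs xi W ->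
  exists h (g : R -> X), [/\ 1 <= h, g 0 = x,
    ((v x - v (g h) - e)%:E <= reward A 0 h g)%E,
    W (martin_embed A b (g h)) & - e <= green A b (g h) + v (g h)].
Proof.
move=> e0 Wxi; have e3 : 0 < e / 3 by lra.
(* e/3 is lost in A^1, then e/3 in K(z,y) and e/3 in A^*(b,y) *)
have [z xz] : exists z, ((v x - v z - e / 3)%:E < A 1 x z)%E.
  have [[_ /(_ 1 ler01) Av] _] := xi_min.
  have : ((v x - e / 3)%:E < martin_fun xi x)%E.
    by rewrite lte_fin ltrBlDr ltrDl.
  rewrite -[in ltRHS]Av => /ereal_sup_gt[_ [z _ <-]] xz; exists z.
  by rewrite addrAC EFinB lteBlDr.
have Wz := nbhs_martin z e3.
have [y [[Wy /= Kzy] by_e]] := minimal_near e3 (filterI Wxi Wz).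
have [t t0 zy] : exists2 t, 0 <= t & ((v z - v y - 2 * (e / 3))%:E < A t z y)%E.
  have : ((v z - v y - 2 * (e / 3))%:E < Astar A z y)%E.
    rewrite -greenE// lte_fin.
    move: Kzy; rewrite [X in `|X - _|]martin_kernelE// ltr_norml.
    by move=> /andP[K1 K2]; lra.
  by move=> /ereal_sup_gt[_ [t t0 <-]] zy; exists t.
have t1 : 0 <= 1 + t by rewrite addr_ge0.
have : ((v x - v y - e)%:E < A (1 + t) x y)%E.
  apply: lt_le_trans (semigroup_super semigroupA x y z ler01 t0).
  by apply: le_lt_trans (lteD xz zy); rewrite -EFinD lee_fin; lra.
rewrite pathA// => /ereal_sup_gt[_ [g [g0 gt] <-]] xy.
exists (1 + t), g; rewrite gt; split => //; [by rewrite lerDl|exact: ltW|lra].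
Qed.

(** Every piece starts where the previous one ends; [minimal_step] asks nothing
of its starting point, so the dependent choice carries no invariant. *)
Lemma minimal_itinerary (U : nat -> set (martin_space A b)) :
  (forall k, nbhs xi (U k)) ->
  exists (h : nat -> R) (g : nat -> R -> X), forall k,
    [/\ 1 <= h k, g k (h k) = g k.+1 0,
      ((v (g k 0) - v (g k (h k)) - 2 ^- k.+1)%:E <= reward A 0 (h k) (g k))%E,
      U k (martin_embed A b (g k (h k))) &
      - 2 ^- k.+1 <= green A b (g k (h k)) + v (g k (h k))].
Proof.
move=> Uxi.
have step (kx : nat * X) : exists hg : R * (R -> X),
    [/\ 1 <= hg.1, hg.2 0 = kx.2,
    ((v kx.2 - v (hg.2 hg.1) - 2 ^- kx.1.+1)%:E <= reward A 0 hg.1 hg.2)%E,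
    U kx.1 (martin_embed A b (hg.2 hg.1)) &
    - 2 ^- kx.1.+1 <= green A b (hg.2 hg.1) + v (hg.2 hg.1)].
  have e0 : 0 < 2 ^- kx.1.+1 :> R by rewrite invr_gt0 exprn_gt0.
  by have [h [g hg]] := minimal_step kx.2 e0 (Uxi kx.1); exists (h, g).
have [F FP] := choice step.
pose fix xs k := if k is j.+1 then (F (j, xs j)).2 (F (j, xs j)).1 else b.
exists (fun k => (F (k, xs k)).1), (fun k => (F (k, xs k)).2) => k.
have [h1 g0 gr gU gb] := FP (k, xs k).
have [_ gS0 _ _ _] := FP (k.+1, xs k.+1).
by split => //; rewrite g0.
Qed.

End MinimalPoint.

Theorem proposition3p16 (R : realType) (X : Type) (b : X)
    (A : R -> X -> X -> \bar R)
    (semigroupA : maxplus_semigroup A)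
    (finA : forall x y : X, Astar A x y \is a fin_num)
    (pathA : forall (t : R) (x y : X), 0 <= t ->
      A t x y = ereal_sup [set reward A 0 t gamma
                          | gamma in [set gamma : R -> X |
                                      gamma 0 = x /\ gamma t = y]])
    (fcM : first_countable (martin_space A b))
    (xi : martin_space A b) (xi_min : minimal_boundary A b xi) :
  exists gamma : R -> X,
    almost_geodesic A gamma /\
    martin_embed A b (gamma t) @[t --> +oo%R] --> xi.
Proof.
have [U [Uxi Ubase]] := first_countable_seq xi fcM.
have [h [g hg]] := minimal_itinerary semigroupA finA pathA xi_min Uxi.
have h1 k : 1 <= h k by case: (hg k).
have [gamma gammaE] : exists gamma : R -> X, forall k s,
    switch_time h k <= s <= switch_time h k + h k ->
    gamma s = g k (s - switch_time h k).
  by apply: concat_paths => // k; case: (hg k).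
set v := set_val xi : X -> R.
have v_super := harmonic_super xi_min.
have g_reward k : ((v (g k 0) - v (g k (h k)) - 2 ^- k.+1)%:E <=
    reward A 0 (h k) (g k))%E by case: (hg k).
exists gamma; split; first exact: concat_almost_geodesic g_reward.
apply/martin_cvgP => x.
suff : martin_kernel A b x (gamma t) @[t --> +oo] --> v x by [].
apply/cvgrPdist_le => e e0.
have e4 : 0 < e / 4 by lra.
(* K differs from v(x) by at most e/4 (closeness at the junction) plus two
   errors 2^-(k+1), each less than e/4 *)
have [k0 _ k0U] := near_infty_natSinv_expn_lt (PosNum e4).
have [k1 k1U] := Ubase _ (nbhs_martin xi x e4).
pose k := maxn k0 k1; pose T := switch_time h k.+1.
have ke : 2 ^- k.+1 < e / 4 :> R.
  by have := k0U k.+1; rewrite /= div1r; apply; rewrite leqW// leq_maxl.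
have gammaT : gamma T = g k (h k).
  have h0 : 0 <= h k by apply: le_trans (h1 k).
  by rewrite /T switch_timeS (@gammaE k) ?lexx ?lerDl ?h0// addrC addKr.
have [_ _ _ gU gb] := hg k.
have {gU} := k1U _ (leq_maxr _ _) _ gU.
rewrite /= [X in `|X - _|]martin_kernelE// -gammaT => KT.
rewrite -gammaT in gb.
near=> t; have Tt : T < t by near: t; exact: nbhs_pinfty_gt (num_real T).
have px := concat_green semigroupA finA v_super h1 gammaE g_reward x Tt.
have pb := concat_green semigroupA finA v_super h1 gammaE g_reward b Tt.
have ux := superharmonic_green finA v_super x (gamma t).
have ub := superharmonic_green finA v_super b (gamma t).
rewrite -/v in KT *.
rewrite martin_kernelE// ler_norml.
have v0 := martin_base0 finA xi_min.
move: KT; rewrite ltr_norml => KT; move: px pb ux ub v0 gb KT ke.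
rewrite -/T -/v; lra.
Unshelve. all: by end_near.
Qed.
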